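(* For every rational number $p/q$ with $4/5 \le p/q < 1$, there exist infinitely many $2$-connected (bridgeless) cubic graphs $G$ such that $m_3(G) = p/q$.
   Context: For a bridgeless cubic graph $G$, $m_3(G)$ denotes the maximum, over all choices of three perfect matchings $M_1, M_2, M_3$ of $G$, of $|M_1\cup M_2\cup M_3|$, divided by $|E(G)|$. *)

(* Defs.v *)
From mathcomp Require Import all_boot all_order all_algebra.
Set Implicit Arguments. Unset Strict Implicit. Unset Printing Implicit Defensive.
Import Order.TTheory GRing.Theory Num.Theory.

Section Graphs.
Variable T : finType.
Variable e : rel T.

Definition simple_graph : Prop := symmetric e /\ irreflexive e.

Definition cubic : Prop := forall x : T, #|[set y | e x y]| = 3.

Definition edges : {set {set T}} := [set [set x; y] | x in T, y in T & e x y].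

Definition connected_graph : Prop := forall x y : T, connect e x y.

Definition two_connected : Prop :=
  2 < #|T| /\ connected_graph /\
  forall v x y : T, x != v -> y != v ->
    connect [rel a b | [&& e a b, a != v & b != v]] x y.

Definition perfect_matching (M : {set {set T}}) : bool :=
  (M \subset edges) && [forall x : T, #|[set f in M | x \in f]| == 1].

Definition m3_num : nat :=
  \max_(M : {set {set T}} * {set {set T}} * {set {set T}} |
          [&& perfect_matching M.1.1, perfect_matching M.1.2 & perfect_matching M.2])
     #|M.1.1 :|: M.1.2 :|: M.2|.

Definition m3 : rat := (m3_num%:R / #|edges|%:R)%R.
End Graphs.

(* Main.v *)
Require Import Defs.
From mathcomp Require Import all_boot all_order all_algebra.
From mathcomp Require Import zify lra.
Import Order.TTheory GRing.Theory Num.Theory.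
Local Open Scope ring_scope.

(** Take [m] blocks, [k] of them Petersen graphs and the others pentagonal
    prisms, cut an edge [01] in each of them, and join the blocks in a ring by
    linking vertex [1] of each block to vertex [0] of the next one.  By parity
    a perfect matching of the ring restricts to a perfect matching of every
    block.  Any two distinct perfect matchings of the Petersen graph meet in one
    edge and no three share an edge, so three of them cover at most 12 of its 15
    edges, while the prism is 3-edge-colourable.  Choosing in every block an
    optimal triple with exactly one member through [01] makes the triples glue,
    whence [m3 = (15 m - 3 k) / 15 m], and [k / 5 m] takes every rational value
    in [[0, 1/5]].

    A perfect matching is handled through its involution [mu] (the mate of a
    vertex): twice the size of a union of three matchings is the sum over [x] of
    the number of distinct mates of [x], which is a sum over blocks. *)

(** * Perfect matchings as involutions, and counting edges by mates *)

Section Mates.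
Local Open Scope nat_scope.
Variables (T : finType) (e : rel T).
Hypotheses (e_sym : symmetric e) (e_irr : irreflexive e).

Lemma set2_inj (x : T) : injective (fun y => [set x; y]).
Proof.
move=> y z /= E; have: y \in [set x; z] by rewrite -E !inE eqxx orbT.
rewrite !inE => /orP[/eqP yx|/eqP //]; subst y.
have: z \in [set x; x] by rewrite E !inE eqxx orbT.
by rewrite !inE orbb => /eqP.
Qed.

Lemma edgesP (f : {set T}) : reflect (exists x y, e x y /\ f = [set x; y]) (f \in edges e).
Proof.
apply: (iffP imset2P) => [[x y _]|[x [y [exy ->]]]].
  by rewrite inE => /andP[_ exy] ->; exists x, y.
by exists x y; rewrite ?inE.
Qed.

Lemma edge_at (x : T) (f : {set T}) :
  f \in edges e -> x \in f -> exists2 y, e x y & f = [set x; y].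
Proof.
move=> /edgesP[a [b [eab ->]]]; rewrite !inE => /orP[]/eqP ->; first by exists b.
by exists a; [rewrite e_sym | rewrite setUC].
Qed.

(** Double counting of incident pairs; irreflexivity gives each edge two ends. *)
Lemma double_card_edges (F : {set {set T}}) : F \subset edges e ->
  #|F| * 2 = \sum_x #|[set f in F | x \in f]|.
Proof.
move=> sF; have -> : #|F| * 2 = \sum_(f in F) #|f|.
  rewrite -sum_nat_const; apply: eq_bigr => f /(subsetP sF)/edgesP[x [y [exy ->]]].
  rewrite cards2; case: eqP exy => // ->; by rewrite e_irr.
transitivity (\sum_(f in F) \sum_(x | x \in f) 1).
  by apply: eq_bigr => f _; rewrite sum1_card.
rewrite (exchange_big_dep predT) //=; apply: eq_bigr => x _.
by rewrite -sum1_card; apply: eq_bigl => f; rewrite inE.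
Qed.

Definition is_mate (M : {set {set T}}) (mu : T -> T) :=
  [/\ forall x, e x (mu x), involutive mu
    & forall x, [set f in M | x \in f] = [set [set x; mu x]]].

Lemma perfect_matching_mate (M : {set {set T}}) :
  perfect_matching e M -> exists mu, is_mate M mu.
Proof.
move=> /andP[sM /forallP uM].
have /fin_all_exists[mu Hmu] x : exists y, e x y /\ [set f in M | x \in f] = [set [set x; y]].
  have /cards1P[f Hf] := uM x.
  have : f \in [set f in M | x \in f] by rewrite Hf inE.
  rewrite inE => /andP[fM xf].
  have [y exy fE] := edge_at x f (subsetP sM _ fM) xf.
  by exists y; rewrite Hf fE.
exists mu; split => [x|x|x]; try by case: (Hmu x).
have [_ Ex] := Hmu x; have [_ Ey] := Hmu (mu x).
have : [set x; mu x] \in [set f in M | x \in f] by rewrite Ex inE.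
rewrite inE => /andP[inM _].
(* The edge of [M] at [x] also contains [mu x], so by uniqueness it is the edge at [mu x]. *)
have : [set x; mu x] \in [set f in M | mu x \in f] by rewrite !inE inM eqxx orbT.
by rewrite Ey inE setUC => /eqP/set2_inj.
Qed.

Lemma mate_perfect_matching (mu : T -> T) :
  (forall x, e x (mu x)) -> involutive mu ->
  perfect_matching e [set [set x; mu x] | x : T]
  /\ is_mate [set [set x; mu x] | x : T] mu.
Proof.
move=> emu muK; set M := [set _ | x : T].
have HM x : [set f in M | x \in f] = [set [set x; mu x]].
  apply/setP => f; rewrite !inE; apply/andP/eqP => [[/imsetP[y _ ->]]|->].
    by rewrite !inE => /orP[]/eqP -> //; rewrite muK setUC.
  by split; [apply/imsetP; exists x | rewrite !inE eqxx].
split; last by split.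
apply/andP; split; last by apply/forallP => x; rewrite HM cards1.
by apply/subsetP => f /imsetP[x _ ->]; apply/edgesP; exists x, (mu x).
Qed.

(** The size of the set {a, b, c}. Any [eqType] is allowed, since both vertices of the ring and
    positions in a block are counted. *)
Definition ndist {A : eqType} (a b c : A) : nat :=
  (b != a) + ((c != a) && (c != b)) + 1.

Lemma ndist_le3 {A : eqType} (a b c : A) : ndist a b c <= 3.
Proof. by rewrite /ndist; do 2 case: (_ != _); case: (_ != _). Qed.

Lemma card_set3 (a b c : T) : #|[set a; b; c]| = ndist a b c.
Proof.
rewrite setUC cardsU1 cards2 !inE /ndist (eq_sym a b) negb_or; lia.
Qed.

(** At each [x], the edges of the union correspond one to one to the distinct mates of [x]. *)
Lemma card_union_mates (M1 M2 M3 : {set {set T}}) (mu1 mu2 mu3 : T -> T) :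
  perfect_matching e M1 -> perfect_matching e M2 -> perfect_matching e M3 ->
  is_mate M1 mu1 -> is_mate M2 mu2 -> is_mate M3 mu3 ->
  #|M1 :|: M2 :|: M3| * 2 = \sum_x ndist (mu1 x) (mu2 x) (mu3 x).
Proof.
move=> /andP[s1 _] /andP[s2 _] /andP[s3 _] [_ _ H1] [_ _ H2] [_ _ H3].
rewrite double_card_edges; last by rewrite !subUset s1 s2 s3.
apply: eq_bigr => x _; rewrite -card_set3 -(card_imset _ (set2_inj x)).
rewrite !imsetU !imset_set1 -H1 -H2 -H3; apply: eq_card => f.
by rewrite !inE !andb_orl.
Qed.

Lemma card_cubic_edges : cubic e -> #|edges e| * 2 = #|T| * 3.
Proof.
move=> e3; rewrite double_card_edges // -sum_nat_const; apply: eq_bigr => x _.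
rewrite -(e3 x) -(card_imset _ (set2_inj x)); apply: eq_card => f; rewrite inE.
apply/andP/imsetP => [[fE xf]|[y]].
  by have [y exy ->] := edge_at x f fE xf; exists y; rewrite ?inE.
by rewrite inE => exy ->; split; [apply/edgesP; exists x, y | rewrite !inE eqxx].
Qed.

End Mates.

(** * The two blocks and their finite checks *)

Section Blocks.
Local Open Scope nat_scope.

(* Neighbours in the Petersen graph ([c = true]) or in the pentagonal prism: the
   outer cycle is 0..4, the spokes join [a] to [a + 5]. *)
Definition nb (c : bool) (a : nat) : seq nat :=
  let s := if c then 2 else 1 in
  if a < 5 then [:: (a + 1) %% 5; (a + 4) %% 5; a + 5]
  else [:: 5 + (a + s) %% 5; 5 + (a + (5 - s)) %% 5; a - 5].

Lemma all_lt10 (P : pred nat) : all P (iota 0 10) -> forall a, a < 10 -> P a.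
Proof. by move=> /allP H a a10; apply: H; rewrite mem_iota. Qed.

Lemma nb_lt10 c a b : a < 10 -> b \in nb c a -> b < 10.
Proof.
move=> a10; apply/allP: b; move: a a10.
by case: c; apply: all_lt10; vm_compute.
Qed.

Lemma nb_sym c a b : a < 10 -> b \in nb c a -> a \in nb c b.
Proof.
move=> a10; apply: (allP (_ : all (fun b => a \in nb c b) (nb c a))).
move: a a10.
by case: c; apply: all_lt10; vm_compute.
Qed.

Lemma nb_irr c a : a < 10 -> a \notin nb c a.
Proof. by move: a; case: c; apply: all_lt10; vm_compute. Qed.

Lemma nb_uniq c a : a < 10 -> uniq (nb c a).
Proof. by move: a; case: c; apply: all_lt10; vm_compute. Qed.

Lemma size_nb c a : size (nb c a) = 3.
Proof. by rewrite /nb; case: ifP. Qed.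

Lemma nb_cut c : (1 \in nb c 0) && (0 \in nb c 1).
Proof. by case: c. Qed.

Definition cut (a b : nat) := (a == 0) && (b == 1) || (a == 1) && (b == 0).

(* The edge 01 is exempt: the mates of 0 and 1 along it lie in other blocks.
   Parity, which would restore the involution, is left to the enumeration. *)
Definition block_mate (s : seq nat) : bool :=
  all (fun a => cut a (nth 0 s a) || (nth 0 s (nth 0 s a) == a)) (iota 0 10).

(** The search space for mate tables: 3^10 candidates when [r] lists all ten vertices. *)
Fixpoint nb_choices (r : seq nat) : seq (seq nat) :=
  if r is a :: r' then [seq x :: s | x <- nb true a, s <- nb_choices r'] else [:: [::]].

Lemma mem_nb_choices (f : nat -> nat) (r : seq nat) :
  (forall a, a \in r -> f a \in nb true a) -> map f r \in nb_choices r.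
Proof.
elim: r => [|a r IH] Hf //; apply/allpairsP; exists (f a, map f r).
split => //=; first by apply: Hf; rewrite mem_head.
by apply: IH => b br; apply: Hf; rewrite inE br orbT.
Qed.

(** The six perfect matchings of the Petersen graph; entry [a] is the mate of [a]. *)
Definition petersen_mates : seq (seq nat) :=
  [:: [:: 5; 6; 7; 8; 9; 0; 1; 2; 3; 4];
      [:: 5; 2; 1; 4; 3; 0; 8; 9; 6; 7];
      [:: 4; 6; 3; 2; 0; 8; 1; 9; 5; 7];
      [:: 1; 0; 7; 4; 3; 8; 9; 2; 5; 6];
      [:: 4; 2; 1; 8; 0; 7; 9; 5; 3; 6];
      [:: 1; 0; 3; 2; 9; 7; 8; 5; 6; 4]].

(** If just one of 0 and 1 had the other as its mate, the nine vertices besides it would pair off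
    among themselves, which is impossible; so only true perfect matchings survive. *)
Lemma petersen_matesP :
  all (fun s => block_mate s ==> (s \in petersen_mates)) (nb_choices (iota 0 10)).
Proof. by vm_compute. Qed.

Definition block_count (s1 s2 s3 : seq nat) : nat :=
  sumn [seq ndist (nth 0 s1 a) (nth 0 s2 a) (nth 0 s3 a) | a <- iota 0 10].

(** 24 is twice the 12 edges that three matchings can cover: each edge is counted at both ends. *)
Lemma petersen_count :
  all (fun s1 => all (fun s2 => all (fun s3 => block_count s1 s2 s3 <= 24)
    petersen_mates) petersen_mates) petersen_mates.
Proof. by vm_compute. Qed.

Definition is_block_mate (f : nat -> nat) :=
  forall a, a < 10 -> f a \in nb true a /\ (cut a (f a) \/ f (f a) = a).

Lemma is_block_mateP f : is_block_mate f -> map f (iota 0 10) \in petersen_mates.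
Proof.
move=> Hf; have := allP petersen_matesP (map f (iota 0 10)) _ => /(_ _)/implyP-> //.
  by apply: mem_nb_choices => a; rewrite mem_iota => /andP[_ /Hf[]].
apply/allP => a; rewrite mem_iota => /andP[_ a10]; have [fa Ha] := Hf a a10.
have fa10 := nb_lt10 true a (f a) a10 fa.
have nthE b : b < 10 -> nth 0 (map f (iota 0 10)) b = f b.
  by move=> b10; rewrite (nth_map 0) ?size_iota // nth_iota.
cbv beta; rewrite !nthE //.
by case: Ha => [->|->]; rewrite ?eqxx ?orbT.
Qed.

Lemma petersen_block_bound f g h :
  is_block_mate f -> is_block_mate g -> is_block_mate h ->
  \sum_(a < 10) ndist (f a) (g a) (h a) <= 24.
Proof.
move=> /is_block_mateP F /is_block_mateP G /is_block_mateP H.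
have := allP (allP (allP petersen_count _ F) _ G) _ H.
rewrite /block_count sumnE big_map -[iota 0 10]/(index_iota 0 10) big_mkord.
congr (_ <= _); apply: eq_bigr => a _.
by rewrite !(nth_map 0 0 _) ?size_iota // !nth_iota.
Qed.

(* In both blocks the edge 01 is used by the matching [j = 0] only, so that the
   matchings with the same [j] glue along the ring. *)
Definition mate_table (c : bool) (j : nat) : seq nat :=
  nth [::] (if c then
    [:: [:: 1; 0; 3; 2; 9; 7; 8; 5; 6; 4];
        [:: 5; 2; 1; 4; 3; 0; 8; 9; 6; 7];
        [:: 4; 6; 3; 2; 0; 8; 1; 9; 5; 7]]
  else
    [:: [:: 1; 0; 3; 2; 9; 6; 5; 8; 7; 4];
        [:: 5; 2; 1; 4; 3; 0; 7; 6; 9; 8];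
        [:: 4; 6; 7; 8; 0; 9; 1; 2; 3; 5]]) j.

Definition tmate c j a := nth 0 (mate_table c j) a.

Lemma tmate_nb c j a : j < 3 -> a < 10 -> tmate c j a \in nb c a.
Proof.
by case: c; case: j => [|[|[|]]] // _; move: a; apply: all_lt10; vm_compute.
Qed.

Lemma tmateK c j a : j < 3 -> a < 10 -> tmate c j (tmate c j a) = a.
Proof.
move=> j3 a10; apply/eqP; move: j3 a10.
by case: c; case: j => [|[|[|]]] // _; move: a; apply: all_lt10; vm_compute.
Qed.

(** A mate across a link may lie in a block of the other kind [c'], so the two tables must agree
    along 01. *)
Lemma tmate_cut c c' j a : j < 3 -> a < 10 -> cut a (tmate c j a) ->
  tmate c' j (tmate c j a) = a.
Proof.
move=> j3 a10 C; apply/eqP; move: C; apply/implyP; move: j3 a10.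
by case: c; case: c'; case: j => [|[|[|]]] // _; move: a; apply: all_lt10; vm_compute.
Qed.

Lemma tmate_count c :
  \sum_(a < 10) ndist (tmate c 0 a) (tmate c 1 a) (tmate c 2 a) = if c then 24 else 30.
Proof.
have -> : \sum_(a < 10) ndist (tmate c 0 a) (tmate c 1 a) (tmate c 2 a) =
  block_count (mate_table c 0) (mate_table c 1) (mate_table c 2).
  by rewrite /block_count sumnE big_map -[iota 0 10]/(index_iota 0 10) big_mkord.
by case: c; vm_compute.
Qed.

(** One step of a graph search in the block without the edge 01 and the vertex [v]. *)
Definition grow (c : bool) (v : nat) (s : seq nat) : seq nat :=
  [seq b <- iota 0 10 | (b != v) &&
     ((b \in s) || has (fun a => (b \in nb c a) && ~~ cut a b) s)].

(* [v = 10] means that no vertex is deleted. *)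
Lemma block_connected_comp c v :
  v <= 10 -> all (fun h => (h != v) ==>
    all (fun b => (b != v) ==> (b \in iter 10 (grow c v) [:: h])) (iota 0 10)) (iota 0 10).
Proof.
move=> v10; have: v \in iota 0 11 by rewrite mem_iota.
move: v {v10}; apply/allP; by case: c; vm_compute.
Qed.

End Blocks.

(** * The ring of blocks *)

Section Ring.
Local Open Scope nat_scope.
Variables (m k : nat) (T : finType).
Variables (phi : T -> 'I_m * 'I_10) (psi : 'I_m * 'I_10 -> T).
Hypotheses (phiK : cancel phi psi) (psiK : cancel psi phi).

Local Notation blk x := (phi x).1.
Local Notation pos x := (nat_of_ord (phi x).2).

(** The block reached from block [i] by an edge from position [a] to position [b]. Relinking keeps
    the positions of both ends of 01 and alters only the block, so locally the ring looks like the
    uncut block. *)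
Definition shift (a b : nat) (i : 'I_m) : 'I_m :=
  if (a == 1) && (b == 0) then ordS i
  else if (a == 0) && (b == 1) then ord_pred i else i.

Definition ring_rel : rel T := fun x y =>
  (pos y \in nb (blk x < k) (pos x)) && (blk y == shift (pos x) (pos y) (blk x)).

Lemma shiftK a b i : shift b a (shift a b i) = i.
Proof.
rewrite /shift; case: a => [|[|a]]; case: b => [|[|b]] //=.
  exact: ord_predK.
exact: ordSK.
Qed.

Lemma shift_id a b i : ~~ cut a b -> shift a b i = i.
Proof. by rewrite /shift /cut negb_or; case/andP => /negbTE-> /negbTE->. Qed.

Lemma ring_relP x y : reflect
  (pos y \in nb (blk x < k) (pos x) /\ blk y = shift (pos x) (pos y) (blk x))
  (ring_rel x y).
Proof. by apply: (iffP andP) => -[? /eqP]. Qed.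

Lemma ring_rel_sym : symmetric ring_rel.
Proof.
suff S x y : ring_rel x y -> ring_rel y x by move=> x y; apply/idP/idP; apply: S.
move=> /ring_relP[yx yb]; apply/ring_relP; split; last by rewrite yb shiftK.
case: (boolP (cut (pos x) (pos y))) => [|nc].
  (* The linked blocks may differ in kind, but 01 is an edge of both. *)
  by case/orP => /andP[/eqP-> /eqP->]; case/andP: (nb_cut (blk y < k)).
by rewrite yb shift_id //; apply: nb_sym.
Qed.

Lemma ring_rel_irr : irreflexive ring_rel.
Proof. by move=> x; apply/negbTE; rewrite negb_and nb_irr. Qed.

(** The positions of both ends determine the block of a neighbour. Hence mates of [x] can be
    compared by position alone, which makes the count local to a block. *)
Lemma ring_nb_pos_inj x y z : ring_rel x y -> ring_rel x z -> (y == z) = (pos y == pos z).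
Proof.
move=> /ring_relP[_ yb] /ring_relP[_ zb]; apply/eqP/eqP => [->//|E].
apply: (can_inj phiK); apply/eqP; rewrite -pair_eqE /pair_eq yb zb E eqxx /=.
by apply/eqP/val_inj.
Qed.

Definition nbr x b : T := psi (shift (pos x) b (blk x), inord b).

Lemma nbrP x b : b \in nb (blk x < k) (pos x) ->
  [/\ ring_rel x (nbr x b), pos (nbr x b) = b & blk (nbr x b) = shift (pos x) b (blk x)].
Proof.
move=> bx; have b10 := nb_lt10 _ _ _ (ltn_ord _) bx.
have pE : pos (nbr x b) = b by rewrite psiK inordK.
have kE : blk (nbr x b) = shift (pos x) b (blk x) by rewrite psiK.
by split => //; apply/ring_relP; rewrite pE kE.
Qed.

Lemma ring_cubic : cubic ring_rel.
Proof.
move=> x; rewrite -(size_nb (blk x < k) (pos x)) -(size_map (nbr x)).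
have /card_uniqP <- : uniq (map (nbr x) (nb (blk x < k) (pos x))).
  rewrite map_inj_in_uniq ?nb_uniq // => a b /nbrP[_ pa _] /nbrP[_ pb _] E.
  by rewrite -pa -pb E.
apply: eq_card => y; rewrite inE; apply/idP/mapP => [xy|[b /nbrP[? _ _] ->] //].
have /ring_relP[yx _] := xy; exists (pos y) => //.
by have [xn pn _] := nbrP _ _ yx; apply/eqP; rewrite (ring_nb_pos_inj x) // pn.
Qed.

Lemma sum_blocks (F : T -> nat) : \sum_x F x = \sum_i \sum_a F (psi (i, a)).
Proof.
rewrite pair_big (reindex psi) /=; last by exists phi => x _; [apply: psiK|apply: phiK].
by apply: eq_bigr => -[i a].
Qed.

(** * The value of [m3_num] on the ring *)

Section Bounds.
Hypothesis km : k <= m.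

Lemma sum_block_sizes : \sum_(i < m) (if i < k then 24 else 30) = 30 * m - 6 * k.
Proof.
rewrite -(big_mkord predT (fun i => if i < k then 24 else 30)).
rewrite (big_cat_nat (n := k)) //= (eq_big_nat _ _ (F2 := fun=> 24)); last first.
  by move=> i /andP[_ ->].
rewrite [X in _ + X](eq_big_nat _ _ (F2 := fun=> 30)); last first.
  by move=> i /andP[ki _]; rewrite ltnNge ki.
rewrite !sum_nat_const_nat; lia.
Qed.

Lemma mate_is_block_mate (mu : T -> T) (i : 'I_m) : i < k ->
  (forall x, ring_rel x (mu x)) -> involutive mu ->
  is_block_mate (fun a => pos (mu (psi (i, inord a)))).
Proof.
move=> ik emu muK a a10; have /ring_relP := emu (psi (i, inord a)).
rewrite !psiK /= ik inordK // => -[pN bE]; split => //.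
case: (boolP (cut _ _)) => nc; [by left | right].
(* Off the cut edge the mate stays in block [i], so the involution of the ring restricts there. *)
rewrite shift_id // in bE.
have -> : psi (i, inord (pos (mu (psi (i, inord a))))) = mu (psi (i, inord a)).
  by rewrite inord_val -{1}bE -surjective_pairing phiK.
by rewrite muK psiK /= inordK.
Qed.

Lemma m3_num_le : m3_num ring_rel <= 15 * m - 3 * k.
Proof.
apply/bigmax_leqP => -[[M1 M2] M3] /= /and3P[P1 P2 P3].
have [mu1 H1] := perfect_matching_mate _ _ ring_rel_sym _ P1.
have [mu2 H2] := perfect_matching_mate _ _ ring_rel_sym _ P2.
have [mu3 H3] := perfect_matching_mate _ _ ring_rel_sym _ P3.
rewrite -(leq_pmul2r (isT : 0 < 2)).
rewrite (card_union_mates _ _ ring_rel_irr _ _ _ _ _ _ P1 P2 P3 H1 H2 H3).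
have -> : (15 * m - 3 * k) * 2 = 30 * m - 6 * k by lia.
rewrite sum_blocks -sum_block_sizes; apply: leq_sum => i _.
have [[e1 K1 _] [e2 K2 _] [e3 K3 _]] := And3 H1 H2 H3.
case: ifP => ik; last first.
  (* A prism gets the trivial bound: three mates at each of ten vertices. *)
  apply: leq_trans (_ : \sum_(a < 10) 3 <= _); first by apply: leq_sum => a _; apply: ndist_le3.
  by rewrite sum_nat_const card_ord.
have := petersen_block_bound _ _ _ (mate_is_block_mate _ _ ik e1 K1)
  (mate_is_block_mate _ _ ik e2 K2) (mate_is_block_mate _ _ ik e3 K3).
congr (_ <= _); apply: eq_bigr => a _.
by rewrite /ndist !(ring_nb_pos_inj (psi (i, a))) // inord_val.
Qed.

Definition ring_mate (j : nat) (x : T) : T := nbr x (tmate (blk x < k) j (pos x)).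

Lemma ring_mateP j x : j < 3 -> ring_rel x (ring_mate j x) /\
  pos (ring_mate j x) = tmate (blk x < k) j (pos x).
Proof. by move=> j3; case: (nbrP x _ (tmate_nb (blk x < k) j (pos x) j3 (ltn_ord _))). Qed.

Lemma ring_mateK j : j < 3 -> involutive (ring_mate j).
Proof.
move=> j3 x; have [xy pE] := ring_mateP j x j3; set y := ring_mate j x in xy pE *.
have [yz pz] := ring_mateP j y j3.
apply/eqP; rewrite (ring_nb_pos_inj y) //; last by rewrite ring_rel_sym.
rewrite pz pE; have /ring_relP[_ yb] := xy.
case: (boolP (cut (pos x) (pos y))) => nc.
  by rewrite tmate_cut // -pE.
by rewrite yb shift_id // tmateK.
Qed.

(** The three glued table matchings attain the optimum in every block at once. *)
Lemma m3_num_ge : 15 * m - 3 * k <= m3_num ring_rel.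
Proof.
have emu j (j3 : j < 3) x : ring_rel x (ring_mate j x) by case: (ring_mateP j x j3).
have [P0 H0] := mate_perfect_matching _ _ _ (emu 0 isT) (ring_mateK 0 isT).
have [P1 H1] := mate_perfect_matching _ _ _ (emu 1 isT) (ring_mateK 1 isT).
have [P2 H2] := mate_perfect_matching _ _ _ (emu 2 isT) (ring_mateK 2 isT).
move: P0 P1 P2 H0 H1 H2.
set M0 := (X in perfect_matching _ X) => P0; set M1 := (X in perfect_matching _ X) => P1.
set M2 := (X in perfect_matching _ X) => P2 H0 H1 H2.
apply: leq_trans (_ : #|M0 :|: M1 :|: M2| <= _); last first.
  by apply: (bigop.bigmax_sup (M0, M1, M2)) => //=; rewrite P0 P1 P2.
rewrite -(leq_pmul2r (isT : 0 < 2)).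
rewrite (card_union_mates _ _ ring_rel_irr _ _ _ _ _ _ P0 P1 P2 H0 H1 H2).
have -> : (15 * m - 3 * k) * 2 = 30 * m - 6 * k by lia.
rewrite sum_blocks -sum_block_sizes; apply: leq_sum => i _.
rewrite -tmate_count; apply: leq_sum => a _.
rewrite /ndist !(ring_nb_pos_inj (psi (i, a))); try exact: emu.
have pE j (j3 : j < 3) : pos (ring_mate j (psi (i, a))) = tmate (i < k) j a.
  by case: (ring_mateP j (psi (i, a)) j3) => _ ->; rewrite psiK.
by rewrite !pE.
Qed.

Lemma m3_numE : m3_num ring_rel = 15 * m - 3 * k.
Proof. by apply/eqP; rewrite eqn_leq m3_num_le m3_num_ge. Qed.

End Bounds.

Lemma card_ring : #|T| = 10 * m.
Proof.
by rewrite (bij_eq_card (Bijective phiK psiK)) card_prod !card_ord mulnC.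
Qed.

Lemma card_ring_edges : #|edges ring_rel| = 15 * m.
Proof.
have := card_cubic_edges _ _ ring_rel_sym ring_rel_irr ring_cubic.
rewrite card_ring; lia.
Qed.

(** * 2-connectivity of the ring *)

Section Connectivity.
Hypothesis m2 : 1 < m.
Variable v : T.

Local Notation del := [rel a b | [&& ring_rel a b, a != v & b != v]].

Lemma del_sym : connect_sym del.
Proof.
by apply: sym_connect_sym => x y /=; rewrite ring_rel_sym; congr andb; apply: andbC.
Qed.

Lemma grow_connect (i : 'I_m) (w h b : nat) n :
  (forall a, a < 10 -> a != w -> psi (i, inord a) != v) ->
  h < 10 -> h != w ->
  b \in iter n (grow (i < k) w) [:: h] -> connect del (psi (i, inord h)) (psi (i, inord b)).
Proof.
move=> nv h10 hw; suff: b \in iter n (grow (i < k) w) [:: h] ->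
  [/\ b < 10, b != w & connect del (psi (i, inord h)) (psi (i, inord b))].
  by move=> H /H[].
elim: n b => [|n IH] b /=; first by rewrite inE => /eqP->; split.
rewrite mem_filter mem_iota => /andP[/andP[bw]] /orP[/IH[//]|/hasP[a /IH[a10 aw ca] /andP[ba nc]]] b10.
split => //; apply: connect_trans ca (connect1 _) => /=.
by rewrite !nv // !andbT; apply/ring_relP; rewrite !psiK /= !inordK // shift_id.
Qed.

Lemma block_connect x y : blk x = blk y -> x != v -> y != v -> connect del x y.
Proof.
(* Only the block containing [v] loses a position; 10 is not a position. *)
move=> E xv yv; pose w := if blk x == blk v then pos v else 10.
have nv a : a < 10 -> a != w -> psi (blk x, inord a) != v.
  rewrite /w => a10; case: (eqVneq (blk x) (blk v)) => [bE|bE _].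
    by apply: contra => /eqP <-; rewrite psiK /= inordK.
  by apply: contra bE => /eqP <-; rewrite psiK.
have w10 : w <= 10 by rewrite /w; case: ifP => // _; apply: ltnW.
have posw z : blk z = blk x -> z != v -> pos z != w.
  move=> zx zv; rewrite /w; case: (eqVneq (blk x) (blk v)) => bE; last by rewrite neq_ltn ltn_ord.
  apply: contra zv => /eqP pE; apply/eqP; apply: (can_inj phiK).
  apply/eqP; rewrite -pair_eqE /pair_eq zx bE eqxx /=; by apply/eqP/val_inj.
have psiE z : blk z = blk x -> psi (blk x, inord (pos z)) = z.
  by move=> <-; rewrite inord_val -surjective_pairing phiK.
rewrite -(psiE x) // -(psiE y) //; apply: (@grow_connect _ w _ _ 10) => //.
  exact: posw.
have /allP/(_ (pos x)) := block_connected_comp (blk x < k) w w10.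
rewrite mem_iota ltn_ord => /(_ isT)/implyP/(_ (posw _ erefl xv)).
by move=> /allP/(_ (pos y)); rewrite mem_iota ltn_ord => /(_ isT)/implyP; apply; apply: posw.
Qed.

Lemma link_rel (i : 'I_m) : ring_rel (psi (i, inord 1)) (psi (ordS i, inord 0)).
Proof.
apply/ring_relP; rewrite !psiK /= !inordK //; split => //.
Qed.

Lemma val_iter_ordS (i : 'I_m) t : val (iter t (@ordS m) i) = (i + t) %% m.
Proof.
elim: t => [|t IH] /=; first by rewrite addn0 modn_small.
by rewrite IH addnS -addn1 modnDml addn1.
Qed.

Lemma iter_ordS_surj (i j : 'I_m) : exists t, j = iter t.+1 (@ordS m) i.
Proof.
(* At least one step is taken: a full turn when [i = j]. *)
exists (j + m - i).-1; apply: val_inj; rewrite val_iter_ordS.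
have -> : i + (j + m - i).-1.+1 = j + m by have := ltn_ord i; have := ltn_ord j; lia.
by rewrite modnDr modn_small.
Qed.

Lemma ordS_neq (i : 'I_m) : ordS i != i.
Proof.
apply/eqP => /(congr1 val) /=; have := ltn_ord i; rewrite leq_eqVlt => /orP[/eqP E|im].
  by rewrite E modnn => i0; rewrite -i0 in E; lia.
by rewrite modn_small //; lia.
Qed.

Lemma blk_neq (i : 'I_m) a : i != blk v -> psi (i, a) != v.
Proof. by apply: contra => /eqP <-; rewrite psiK. Qed.

(** Induction on the number of links from the block of [v] forward to that of [x]: walk back block
    by block until the one just after the block of [v]. *)
Lemma connect_hub x : x != v -> connect del x (psi (ordS (blk v), inord 0)).
Proof.
set h := psi _; have hv : h != v by apply: blk_neq; apply: ordS_neq.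
have hb : blk h = ordS (blk v) by rewrite psiK.
have [t] := iter_ordS_surj (blk v) (blk x).
elim: t x => [|t IH] x xt xv; first by apply: block_connect; rewrite // hb.
rewrite iterS in xt; set j := iter t.+1 _ _ in IH xt.
case: (eqVneq j (blk v)) => [jv|jv].
  by apply: block_connect; rewrite // hb xt jv.
(* The way back is barred only if [v] is vertex 0 of the block of [x]; then vertex 1 of that block
   links forward to the hub. *)
case: (eqVneq (psi (ordS j, inord 0)) v) => [zv|zv].
  have jS : ordS j = blk v by rewrite -zv psiK.
  have yv : psi (blk v, inord 1) != v.
    by rewrite -{2}zv -jS (can_eq psiK) xpair_eqE eqxx -val_eqE /= !inordK.
  apply: connect_trans (_ : connect del x (psi (blk v, inord 1))) _.
    by apply: block_connect => //; rewrite psiK xt.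
  by apply: connect1; rewrite /= link_rel yv.
have yv : psi (j, inord 1) != v by apply: blk_neq.
apply: connect_trans (_ : connect del x (psi (ordS j, inord 0))) _.
  by apply: block_connect => //; rewrite psiK.
apply: connect_trans (IH (psi (j, inord 1)) _ yv); last by rewrite psiK.
by rewrite del_sym; apply: connect1; rewrite /= link_rel yv.
Qed.

End Connectivity.

Lemma ring_two_connected : 1 < m -> two_connected ring_rel.
Proof.
move=> m2; have C v x y : x != v -> y != v ->
    connect [rel a b | [&& ring_rel a b, a != v & b != v]] x y.
  move=> xv yv; apply: connect_trans (connect_hub m2 v x xv) _.
  by rewrite del_sym; apply: connect_hub.
split; first by rewrite card_ring; lia.
split => // x y.
(* Plain connectivity follows by deleting some third vertex. *)
have [v] : exists v, v \notin [set x; y].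
  apply/existsP; rewrite -negb_forall; apply/negP => /forallP H.
  have : #|T| <= #|[set x; y]| by apply/subset_leq_card/subsetP => z _; apply: H.
  rewrite card_ring cards2; lia.
rewrite !inE negb_or !(eq_sym v) => /andP[xv yv].
apply: (connect_sub _ (C v x y xv yv)) => a b /and3P[ab _ _].
exact: connect1.
Qed.

End Ring.

(** * Realising a given rational *)

Lemma ring_of_blocks (m k : nat) : (1 < m)%N -> (k <= m)%N ->
  exists e : rel 'I_(10 * m),
    [/\ simple_graph e, cubic e, two_connected e
      & m3 e = (15 * m - 3 * k)%:R / (15 * m)%:R].
Proof.
move=> m2 km; pose B := ('I_m * 'I_10)%type.
have cB : #|{: B}| = (10 * m)%N by rewrite card_prod !card_ord mulnC.
(* Enumerating the pairs turns the vertex set into an ordinal. *)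
rewrite -cB; exists (@ring_rel m k _ (@enum_val B predT)).
have K1 : cancel (@enum_val B predT) (@enum_rank B) by exact: enum_valK.
have K2 : cancel (@enum_rank B) (@enum_val B predT) by exact: enum_rankK.
split.
- split; [exact: ring_rel_sym | exact: ring_rel_irr].
- exact: (ring_cubic _ _ _ _ _ K1 K2).
- exact: (ring_two_connected _ _ _ _ _ K1 K2).
- by rewrite /m3 (m3_numE _ _ _ _ _ K1 K2) // (card_ring_edges _ _ _ _ _ K1 K2).
Qed.

(* "infinitely many": arbitrarily large vertex sets 'I_n with n >= N *)
Theorem theorem1 (r : rat) (hlo : 4%:R / 5%:R <= r) (hhi : r < 1) :
  forall N : nat, exists (n : nat) (e : rel 'I_n),
    (N <= n)%N /\ simple_graph e /\ cubic e /\ two_connected e /\ m3 e = r.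
Proof.
move=> N; have d0 := denq_gt0 r.
have [d dE] : exists d : nat, denq r = d by exists `|denq r|%N; rewrite gtz0_abs.
have r0 : 0 <= r by lra.
have [p pE] : exists p : nat, numq r = p.
  by exists `|numq r|%N; rewrite gez0_abs ?numq_ge0.
have rE : r = p%:R / d%:R by rewrite -[LHS]divq_num_den dE pE.
rewrite dE in d0; have d0r : (0 : rat) < d%:R by rewrite ltr0n.
have pd : (p <= d)%N.
  by move: hhi; rewrite rE ltr_pdivrMr // mul1r ltr_nat => /ltnW.
(* The bound 4/5 <= p/d is exactly what leaves room for the Petersen blocks, [k <= m]. *)
have kd : (5 * (d - p) <= d)%N.
  move: hlo; rewrite rE ler_pdivrMr // mulrAC ler_pdivlMr //.
  rewrite -!natrM ler_nat; lia.
(* Here k / 5m = (d - p) / d = 1 - r. The factor [N.+2] gives at least two blocks and at least [N]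
   vertices. *)
have [||e [se ce te me]] := ring_of_blocks (d * N.+2) (5 * (d - p) * N.+2).
- nia.
- by rewrite leq_mul2r kd orbT.
exists (10 * (d * N.+2))%N, e; split; first by nia.
do 3 split => //; rewrite me rE.
have -> : (15 * (d * N.+2) - 3 * (5 * (d - p) * N.+2) = p * (15 * N.+2))%N.
  have -> : (d = p + (d - p))%N by lia.
  by rewrite addKn; lia.
have -> : (15 * (d * N.+2) = d * (15 * N.+2))%N by lia.
by rewrite !natrM -mulf_div divff ?mulr1 // -natrM pnatr_eq0.
Qed.
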